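(* Let $n$ be a large natural number and consider the $(1:E_b)$-biased games on $K_n$, where $E_b$ denotes a matching of size $b$. Then: (1) the threshold bias for the triangle game $\mathcal{F}_{K_3}(E_b,n)$ is $b=\Theta(n)$; (2) the threshold bias for the connectivity game $\mathcal{C}(E_b,n)$ is $b=\Theta(n)$; (3) the threshold bias for the Hamiltonicity game $\mathcal{H}(E_b,n)$ is $b=\Theta(n)$.
   Context: Structure-biased Maker-Breaker game on $K_n$: the board is the edge set of $K_n$; Maker and Breaker alternate turns; on each turn Maker claims one unclaimed edge, while Breaker claims a set of unclaimed edges forming a subgraph of a copy of a given graph $H$. For the $(1:E_b)$ bias, on each turn Breaker claims a set of at most $b$ pairwise disjoint (vertex-disjoint) unclaimed edges. The game ends when no unclaimed edges remain. In $\mathcal{F}_{K_3}$ Maker wins if her graph contains a triangle; in $\mathcal{C}$ Maker wins if her graph contains a spanning tree of $K_n$; in $\mathcal{H}$ Maker wins if her graph contains a Hamiltonian path of $K_n$; otherwise Breaker wins. The threshold bias is the value $b_0(n)$ such that Breaker wins if $b>b_0$ and Maker wins if $b\le b_0$. Convention: when considering Maker strategies Breaker makes the first move, and when considering Breaker strategies Maker makes the first move. *)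

(* Defs.v *)
From mathcomp Require Import all_boot.

Set Implicit Arguments.
Unset Strict Implicit.
Unset Printing Implicit Defensive.

(* A graph on the vertex set 'I_n is a set of edges, an edge being a
   two-element set of vertices. *)
Notation graph n := {set {set 'I_n}}.

Definition board (n : nat) : graph n := [set e : {set 'I_n} | #|e| == 2].

Definition adj n (G : graph n) : rel 'I_n :=
  [rel u v | (u != v) && ([set u; v] \in G)].

Definition has_triangle n (G : graph n) : Prop :=
  exists u v w : 'I_n, [/\ adj G u v, adj G v w & adj G u w].

Definition spanning_tree n (T : graph n) : Prop :=
  (forall u v : 'I_n, connect (adj T) u v) /\
  (forall c : seq 'I_n, 2 < size c -> ~ ucycle (adj T) c).

Definition has_spanning_tree n (G : graph n) : Prop :=
  exists2 T : graph n, T \subset G & spanning_tree T.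

Definition has_hamiltonian_path n (G : graph n) : Prop :=
  exists p : seq 'I_n, [/\ uniq p, (forall v, v \in p) & sorted (adj G) p].

Inductive player := Maker | Breaker.

Definition opponent (pl : player) : player :=
  if pl is Maker then Breaker else Maker.

Record position n := Position { maker_graph : graph n; breaker_graph : graph n }.

Definition start n : position n := Position set0 set0.

Definition unclaimed n (p : position n) : graph n :=
  board n :\: (maker_graph p :|: breaker_graph p).

(* Strategies are positional: a player's choice depends on the edges claimed so
   far by each side.  No position occurs twice with the same player to move
   before the end of the game, so dependence on the history adds nothing. *)
Definition maker_strategy n := position n -> {set 'I_n}.
Definition breaker_strategy n := position n -> graph n.

Definition maker_legal n (s : maker_strategy n) : Prop :=
  forall p, unclaimed p != set0 -> s p \in unclaimed p.

(* trivIset: the claimed edges are pairwise vertex-disjoint. *)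
Definition breaker_legal n (b : nat) (t : breaker_strategy n) : Prop :=
  forall p, [/\ t p \subset unclaimed p, #|t p| <= b & trivIset (t p)].

Definition turn n (s : maker_strategy n) (t : breaker_strategy n)
    (pl : player) (p : position n) : position n :=
  if unclaimed p == set0 then p else
  match pl with
  | Maker => Position (s p |: maker_graph p) (breaker_graph p)
  | Breaker => Position (maker_graph p) (t p :|: breaker_graph p)
  end.

(* The position after k turns, pl making the first one. *)
Fixpoint play n (s : maker_strategy n) (t : breaker_strategy n)
    (pl : player) (k : nat) (p : position n) : position n :=
  if k is k'.+1 then play s t (opponent pl) k' (turn s t pl p) else p.

(* The graph Maker owns when no unclaimed edge remains is G. *)
Definition final_maker_graph n (s : maker_strategy n) (t : breaker_strategy n)
    (first : player) (G : graph n) : Prop :=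
  exists k, unclaimed (play s t first k (start n)) = set0 /\
            maker_graph (play s t first k (start n)) = G.

Definition maker_wins n (goal : graph n -> Prop) (first : player) (b : nat) :
    Prop :=
  exists2 s : maker_strategy n, maker_legal s &
  forall t : breaker_strategy n, breaker_legal b t ->
  exists2 G, final_maker_graph s t first G & goal G.

Definition breaker_wins n (goal : graph n -> Prop) (first : player) (b : nat) :
    Prop :=
  exists2 t : breaker_strategy n, breaker_legal b t &
  forall s : maker_strategy n, maker_legal s ->
  exists2 G, final_maker_graph s t first G & ~ goal G.

(* A matching of size b lies in K_n only when b <= n./2, so the bias b and its
   threshold b0 range over 0, ..., n./2. *)
Definition is_threshold_bias n (goal : graph n -> Prop) (first : player)
    (b0 : nat) : Prop :=
  b0 <= n./2 /\
  forall b, b <= n./2 ->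
    (b0 < b -> breaker_wins goal first b) /\
    (b <= b0 -> maker_wins goal first b).

(* Main.v *)
Require Import Defs.
From mathcomp Require Import all_boot zify boolp.

(**
The game is finite, hence determined, and the set of biases with which Maker
wins is closed downwards; so the threshold is the largest such bias, and it is
at most [n./2]. It remains to let Maker win with a linear bias. Breaker's edges
form a matching, so of two threats sharing a vertex he can only parry one.

Triangle: Maker claims edges [va1], [va2], [va3] with [a1a3], [a2a3] free;
Breaker cannot parry both threats at [a3].

Hamiltonian path (hence spanning tree): Maker grows a path by absorbing, in two
moves, the outside vertex [u] with the most Breaker edges. While the path is
short, with ends [x] and [y], she picks a fresh [z] with [uz], [xz], [yz] free,
claims [uz], and then [xz] or [yz]. Once the path is long, [u] has free edges to
three consecutive vertices [x], [y], [z] of the path; she claims [uy], and then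
[ux] or [uz], inserting [u] next to [y]. Breaker owns few edges in all, so few
vertices ever have large Breaker degree; serving the worst vertex first keeps
the degree of every outside vertex small.
*)

Set Implicit Arguments.
Unset Strict Implicit.
Unset Printing Implicit Defensive.

(** * Determinacy by backward induction *)

Section Determinacy.

Variables (n b : nat) (goal : graph n -> Prop).

Implicit Types (p : position n) (pl : player) (D M B : graph n).

Definition breaker_move p D :=
  [/\ D \subset unclaimed p, #|D| <= b & trivIset D].

Definition after_maker p (e : {set 'I_n}) :=
  Position (e |: maker_graph p) (breaker_graph p).

Definition after_breaker p D :=
  Position (maker_graph p) (D :|: breaker_graph p).

(** Backward induction: the positions from which Maker forces the goal. The negation is what Breaker
    preserves, so excluded middle yields determinacy. *)
Inductive win : player -> position n -> Prop :=
| WinEnd pl p : unclaimed p = set0 -> goal (maker_graph p) -> win pl p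
| WinMaker p e : e \in unclaimed p -> win Breaker (after_maker p e) ->
    win Maker p
| WinBreaker p : unclaimed p != set0 ->
    (forall D, breaker_move p D -> win Maker (after_breaker p D)) ->
    win Breaker p.

Lemma breaker_move0 p : breaker_move p set0.
Proof.
split; first exact: sub0set; first by rewrite cards0.
by apply/trivIsetP => A B; rewrite inE.
Qed.

Lemma unclaimed_after_maker p e : unclaimed (after_maker p e) = unclaimed p :\ e.
Proof. by apply/setP=> x; rewrite !inE; case: (x == e). Qed.

Lemma unclaimed_after_breaker p D :
  unclaimed (after_breaker p D) = unclaimed p :\: D.
Proof.
by apply/setP=> x; rewrite !inE; case: (x \in D); rewrite ?andbF ?orbT.
Qed.

Lemma card_unclaimed_after_maker p e :
  e \in unclaimed p -> #|unclaimed (after_maker p e)| < #|unclaimed p|.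
Proof. by move=> eU; rewrite unclaimed_after_maker [ltnRHS](cardsD1 e) eU. Qed.

Lemma card_unclaimed_after_breaker p D :
  #|unclaimed (after_breaker p D)| <= #|unclaimed p|.
Proof. by rewrite unclaimed_after_breaker subset_leq_card ?subsetDl. Qed.

Lemma win_end pl p : unclaimed p = set0 -> win pl p -> goal (maker_graph p).
Proof.
move=> U0 w; case: w U0 => // [q e eU _ U0|q /negP Un _ U0].
  by rewrite U0 inE in eU.
by rewrite U0 eqxx in Un.
Qed.

(** Once a monotone goal is reached Maker may claim arbitrary edges to the end. Only her turns
    surely shrink the board, so the induction runs over them. *)
Lemma win_of_goal : (forall M M', M \subset M' -> goal M -> goal M') ->
  forall pl p, goal (maker_graph p) -> win pl p.
Proof.
move=> goalS.
have step k : (forall p, #|unclaimed p| <= k -> goal (maker_graph p) ->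
    win Maker p) ->
    forall p, #|unclaimed p| <= k -> goal (maker_graph p) -> win Breaker p.
  move=> wM p pk gp; have [U0|Un0] := eqVneq (unclaimed p) set0.
    exact: WinEnd.
  apply: WinBreaker => // D _; apply: wM => //.
  exact: leq_trans (card_unclaimed_after_breaker p D) pk.
have main k : forall p, #|unclaimed p| <= k -> goal (maker_graph p) ->
    win Maker p.
  elim: k => [|k IH] p pk gp.
    by apply: WinEnd => //; apply/eqP; rewrite -cards_eq0 -leqn0.
  have [U0|/set0Pn[e eU]] := eqVneq (unclaimed p) set0.
    exact: WinEnd.
  apply: (WinMaker eU); apply: (step _ IH).
    by rewrite -ltnS; apply: leq_trans (card_unclaimed_after_maker eU) pk.
  by apply: goalS gp; apply: subsetUr.
case=> p; first exact: main.
exact: step (main _) _ (leqnn _).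
Qed.

Lemma play_invariant s t (Inv : player -> position n -> Prop) :
  maker_legal s -> breaker_legal b t ->
  (forall p, unclaimed p != set0 -> Inv Maker p ->
     Inv Breaker (after_maker p (s p))) ->
  (forall p, unclaimed p != set0 -> Inv Breaker p ->
     Inv Maker (after_breaker p (t p))) ->
  forall pl p, Inv pl p ->
  exists k, unclaimed (play s t pl k p) = set0 /\
            exists pl', Inv pl' (play s t pl k p).
Proof.
move=> sL tL InvM InvB pl p.
(* Breaker may claim nothing, so his turn only spends the extra unit; Maker's turn removes an edge,
   worth 2, and restores that unit. *)
pose m pl p := 2 * #|unclaimed p| + (if pl is Maker then 0 else 1).
have [k] := ubnP (m pl p); elim: k pl p => // k IH pl p; rewrite ltnS => mk I.
have [U0|Un0] := eqVneq (unclaimed p) set0; first by exists 0; split=> //; exists pl.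
have [||j [U0 jI]] := IH (opponent pl) (turn s t pl p).
- apply: leq_trans mk; rewrite /m /turn (negPf Un0).
  case: pl {I}; last first.
    have := card_unclaimed_after_breaker p (t p); rewrite /after_breaker /=; lia.
  have := card_unclaimed_after_maker (sL p Un0); rewrite /after_maker /=; lia.
- rewrite /turn (negPf Un0); case: pl I mk => I _; first exact: InvM.
  exact: InvB.
by exists j.+1.
Qed.

Lemma maker_wins_of_win first : win first (start n) -> maker_wins goal first b.
Proof.
move=> w0.
pose good p e := `[< e \in unclaimed p /\ win Breaker (after_maker p e) >].
(* Where no winning move exists, any unclaimed edge keeps [s] legal; the default [set0] occurs only
   on a full board. *)
pose s p := odflt (odflt set0 [pick e in unclaimed p]) [pick e | good p e].
have sL : maker_legal s.
  move=> p Un0; rewrite /s; case: (pickP (good p)) => [e /asboolP[eU _] //|_] /=.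
  by case/set0Pn: Un0 => e eU; case: pickP => [//|/(_ e)]; rewrite eU.
exists s => // t tL.
have [p Un0 w|p Un0 w|k [U0 [pl w]]] := play_invariant sL tL (Inv := win) _ _ w0.
- rewrite /s; case: (pickP (good p)) => [e0 /asboolP[_ we] //|no].
  have [e eU we] : exists2 e, e \in unclaimed p & win Breaker (after_maker p e).
    inversion_clear w as [? ? U0|? e0 e0U we0|]; last by exists e0.
    by rewrite U0 eqxx in Un0.
  by have /asboolP := conj eU we; rewrite -/(good p e) no.
- inversion_clear w as [? ? U0| |? _ wD]; last exact/wD/tL.
  by rewrite U0 eqxx in Un0.
exists (maker_graph (play s t first k (start n))); last exact: win_end U0 w.
by exists k.
Qed.

Lemma breaker_wins_of_not_win first :
  ~ win first (start n) -> breaker_wins goal first b.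
Proof.
move=> w0.
pose good p D := `[< breaker_move p D /\ ~ win Maker (after_breaker p D) >].
pose t p := odflt set0 [pick D | good p D].
have tL : breaker_legal b t.
  move=> p; rewrite /t; case: (pickP (good p)) => [D /asboolP[pD _] //|_] /=.
  exact: breaker_move0.
exists t => // s sL.
have [p Un0 w|p Un0 w|k [U0 [pl w]]] :=
  play_invariant sL tL (Inv := fun pl p => ~ win pl p) _ _ w0.
- by move=> w'; apply/w/(WinMaker (sL p Un0)).
(* If every legal reply led to a won position, [WinBreaker] would make this one won; so a good reply
   exists. *)
- rewrite /t; case: (pickP (good p)) => [D /asboolP[_ nw] //|no] /= _.
  apply: w; apply: WinBreaker => // D pD; apply: contrapT => wD.
  by have /asboolP := conj pD wD; rewrite -/(good p D) no.
exists (maker_graph (play s t first k (start n))); first by exists k.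
by move=> g; apply: w; apply: WinEnd.
Qed.

End Determinacy.

(** * Existence of the threshold bias *)

Lemma maker_wins_leq n (goal : graph n -> Prop) first b b' :
  b <= b' -> maker_wins goal first b' -> maker_wins goal first b.
Proof.
move=> bb' [s sL sw]; exists s => // t tL; apply: sw => p.
by have [? tb ?] := tL p; split=> //; apply: leq_trans tb bb'.
Qed.

Lemma not_maker_wins n (goal : graph n -> Prop) first b :
  ~ maker_wins goal first b -> breaker_wins goal first b.
Proof. by move=> nw; apply: breaker_wins_of_not_win => /maker_wins_of_win. Qed.

(** Over an empty range the maximum is 0, which is then no threshold; hence the winning [b] in
    [thresholdP]. *)
Definition threshold n (goal : graph n -> Prop) first :=
  \max_(b < n./2.+1 | `[< maker_wins goal first b >]) b.

Lemma threshold_le n (goal : graph n -> Prop) first : threshold goal first <= n./2.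
Proof. by apply/bigmax_leqP => b _; rewrite -ltnS. Qed.

Lemma le_threshold n (goal : graph n -> Prop) first b : b <= n./2 ->
  maker_wins goal first b -> b <= threshold goal first.
Proof.
rewrite -ltnS => bn bw.
by apply: (@leq_bigmax_cond _ _ _ (Ordinal bn)); apply/asboolP.
Qed.

(** A nonempty maximum is attained, so the threshold is itself winning; smaller biases follow by
    monotonicity, larger ones by determinacy. *)
Lemma thresholdP n (goal : graph n -> Prop) first b : b <= n./2 ->
  maker_wins goal first b -> is_threshold_bias goal first (threshold goal first).
Proof.
move=> bn bw; split; first exact: threshold_le.
move=> b' b'n; split=> [lt|le].
  by apply: not_maker_wins => /(le_threshold b'n); rewrite leqNgt lt.
apply: maker_wins_leq le _.
rewrite -ltnS in bn.
have [|i /asboolP iw E] := @eq_bigmax_cond _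
    [pred b : 'I_n./2.+1 | `[< maker_wins goal first b >]] (fun b => b : nat).
  by apply/card_gt0P; exists (Ordinal bn); rewrite inE; apply/asboolP.
by have -> : threshold goal first = i by rewrite -E; apply: eq_bigl.
Qed.

(** * Breaker degrees and free vertices *)

Section Degrees.

Variable n : nat.

Implicit Types (M B D : graph n) (u v w x y z : 'I_n).

Lemma set2_inj v : injective (fun w => [set v; w]).
Proof.
move=> w w' /setP E; have := E w; have := E w'; rewrite !inE !eqxx !orbT.
by rewrite [w' == w]eq_sym; case: (w =P w') => // _; rewrite !orbF => /eqP-> /esym/eqP.
Qed.

Lemma in_unclaimed M B u v :
  ([set u; v] \in unclaimed (Position M B)) =
  [&& u != v, [set u; v] \notin M & [set u; v] \notin B].
Proof. by rewrite !inE cards2 negb_or /=; case: (u != v); rewrite //= andbC. Qed.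

Lemma adj_sym M : symmetric (adj M).
Proof. by move=> u v; rewrite /adj /= eq_sym setUC. Qed.

Lemma adj_sub M M' : M \subset M' -> subrel (adj M) (adj M').
Proof. by move=> /subsetP sub u v /andP[uv /sub uvM']; apply/andP. Qed.

Lemma has_triangle_sub M M' : M \subset M' -> has_triangle M -> has_triangle M'.
Proof.
by move=> /adj_sub sub [u [v [w [/sub ? /sub ? /sub ?]]]]; exists u, v, w.
Qed.

Lemma has_hamiltonian_path_sub M M' :
  M \subset M' -> has_hamiltonian_path M -> has_hamiltonian_path M'.
Proof.
by move=> /adj_sub sub [s [Us sT /(sub_sorted sub) ss]]; exists s.
Qed.

Definition deg B v := #|[set e in B | v \in e]|.

Lemma deg_sub B B' v : B \subset B' -> deg B v <= deg B' v.
Proof.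
move=> sub; apply: subset_leq_card; apply/subsetP=> e; rewrite !inE.
by case/andP=> /(subsetP sub)-> ->.
Qed.

Lemma trivIset_edges_at D v e e' : trivIset D -> e \in D -> e' \in D ->
  v \in e -> v \in e' -> e = e'.
Proof.
move=> /trivIsetP tD eD e'D ve ve'; apply/eqP; apply: contraT => /(tD _ _ eD e'D).
by move=> /pred0P/(_ v) /=; rewrite ve ve'.
Qed.

(** The double-threat principle: distinct edges sharing [v] cannot both lie in one matching, so one
    of two threats at [v] survives Breaker's turn. *)
Lemma trivIset_choice D v w w' : trivIset D -> w != w' ->
  [set v; w] \notin D \/ [set v; w'] \notin D.
Proof.
move=> tD ww'; case: (boolP ([set v; w] \in D)) => [wD|]; [right|by left].
apply: contra ww' => w'D; apply/eqP/(@set2_inj v).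
by apply: (@trivIset_edges_at _ v _ _ tD); rewrite ?inE ?eqxx.
Qed.

Lemma deg_trivIset D v : trivIset D -> deg D v <= 1.
Proof.
move=> tD; apply/card_le1_eqP => e e'.
rewrite !inE => /andP[eD ve] /andP[e'D ve'].
exact: (trivIset_edges_at tD e'D eD ve' ve).
Qed.

Lemma deg_move B D v : trivIset D -> deg (D :|: B) v <= (deg B v).+1.
Proof.
move=> tD; have := deg_trivIset v tD; rewrite /deg.
have -> : [set e in D :|: B | v \in e] =
    [set e in D | v \in e] :|: [set e in B | v \in e].
  by apply/setP=> e; rewrite !inE andb_orl.
have := leq_of_leqif (leq_card_setU [set e in D | v \in e] [set e in B | v \in e]); lia.
Qed.

Definition nbrs B v := [set w | [set v; w] \in B].

Lemma card_nbrs B v : #|nbrs B v| <= deg B v.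
Proof.
rewrite -(card_imset _ (@set2_inj v)); apply: subset_leq_card.
by apply/subsetP=> e /imsetP[w]; rewrite !inE => wB ->; rewrite wB !inE eqxx.
Qed.

Lemma sum_deg B : B \subset board n -> \sum_v deg B v = 2 * #|B|.
Proof.
move=> /subsetP sub; have -> : \sum_v deg B v = \sum_v \sum_(e in B) (v \in e : nat).
  apply: eq_bigr => v _; rewrite /deg -sum1_card big_mkcond [RHS]big_mkcond /=.
  by apply: eq_bigr => e _; rewrite inE; case: (e \in B); case: (v \in e).
rewrite exchange_big /=.
have -> : \sum_(e in B) \sum_v (v \in e : nat) = \sum_(e in B) 2.
  apply: eq_bigr => e /sub; rewrite inE => /eqP <-.
  rewrite -sum1_card [RHS]big_mkcond /=.
  by apply: eq_bigr => v _; case: (v \in e).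
by rewrite sum_nat_const mulnC.
Qed.

(** Union bound over [A] and three Breaker neighbourhoods; a vertex is repeated when fewer
    constraints are wanted. *)
Lemma exists_free_vertex B (A : {set 'I_n}) x y u :
  #|A| + deg B x + deg B y + deg B u < n ->
  exists z, [/\ z \notin A, [set x; z] \notin B, [set y; z] \notin B &
                [set u; z] \notin B].
Proof.
move=> lt; pose F := A :|: nbrs B x :|: nbrs B y :|: nbrs B u.
have ltF : #|F| < n.
  apply: leq_ltn_trans lt.
  do 3![apply: leq_trans (leq_of_leqif (leq_card_setU _ _))
                         (leq_add _ (card_nbrs _ _))].
  exact: leqnn.
have /card_gt0P[z] : 0 < #|~: F| by rewrite cardsCs setCK card_ord subn_gt0.
by rewrite !inE !negb_or => /andP[/andP[/andP[]]] *; exists z.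
Qed.

End Degrees.


(** * One round of play *)

Lemma win_breaker n b (goal : graph n -> Prop) (M B : graph n) :
  (forall D : graph n, D \subset board n -> #|D| <= b -> trivIset D ->
     win b goal Maker (Position M (D :|: B))) ->
  win b goal Breaker (Position M B).
Proof.
move=> wD; have [U0|Un0] := eqVneq (unclaimed (Position M B)) set0.
  (* On a full board the empty matching reduces the claim to the hypothesis. *)
  apply: WinEnd => //=; have [sub cb tr] := breaker_move0 b (Position M B).
  have := wD set0 (sub0set _) cb tr; rewrite set0U; exact: win_end.
apply: WinBreaker => // D [/= sub cD tD]; apply: wD => //.
by apply: subset_trans sub _; apply: subsetDl.
Qed.

Lemma win_round n b (goal : graph n -> Prop) (M B : graph n) u v :
  u != v -> [set u; v] \notin M -> [set u; v] \notin B ->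
  (forall D : graph n, D \subset board n -> #|D| <= b -> trivIset D ->
     win b goal Maker (Position ([set u; v] |: M) (D :|: B))) ->
  win b goal Maker (Position M B).
Proof.
move=> uv uvM uvB wD; apply: (@WinMaker _ _ _ _ [set u; v]).
  by rewrite in_unclaimed uv uvM.
exact: win_breaker.
Qed.

(** * The triangle game *)

Section TriangleGame.

Variables (n b : nat).
Hypothesis n_ge : 20 <= n.

Local Notation win := (win b (@has_triangle n)).

(** [B] is empty when Maker starts and a single matching when Breaker does; either way every degree
    is at most 1. *)
Lemma win_triangle_start (B : graph n) :
  (forall v, deg B v <= 1) -> win Maker (Position set0 B).
Proof.
move=> degB; have n0 : 0 < n by lia.
pose v := Ordinal n0.
have [|a1 [+ fa1 _ _]] := @exists_free_vertex n B [set v] v v v.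
  by rewrite cards1; have := degB v; lia.
rewrite !inE eq_sym => va1.
apply: (win_round va1 _ fa1) => [|D1 _ _ tD1]; first by rewrite inE.
set B1 := D1 :|: B.
have degB1 w : deg B1 w <= 2 by apply: leq_trans (deg_move B w tD1) _; apply: degB.
have [|a2 [+ fa2 _ _]] := @exists_free_vertex n B1 [set v; a1] v v v.
  by rewrite cards2; have := degB1 v; case: (_ != _) => /=; lia.
rewrite !inE !negb_or => /andP[a2v a2a1]; rewrite eq_sym in a2v.
apply: (win_round a2v _ fa2) => [|D2 _ _ tD2].
  by rewrite !inE orbF (inj_eq (@set2_inj n v)).
set B2 := D2 :|: B1.
have degB2 w : deg B2 w <= 3 by apply: leq_trans (deg_move B1 w tD2) _; apply: degB1.
(* At most 3 + 3 * 3 = 12 vertices are excluded, fewer than 20. *)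
have [|a3 [+ fa3 f13 f23]] := @exists_free_vertex n B2 [set v; a1; a2] v a1 a2.
  have cA : #|[set v; a1; a2]| <= 3.
    apply: leq_trans (leq_of_leqif (leq_card_setU _ _)) _.
    by rewrite cards1 cards2; case: (_ != _).
  apply: leq_ltn_trans (leq_add (leq_add (leq_add cA _) _) _) _;
    [exact: degB2|exact: degB2|exact: degB2|lia].
rewrite !inE !negb_or => /andP[/andP[a3v a3a1] a3a2].
rewrite eq_sym in a3v.
apply: (win_round a3v _ fa3) => [|D3 _ _ tD3].
  by rewrite !inE orbF !(inj_eq (@set2_inj n v)) negb_or a3a2.
set M3 := [set v; a3] |: _.
have closing a : a = a1 \/ a = a2 -> [set a3; a] \notin D3 ->
    win Maker (Position M3 (D3 :|: B2)).
  move=> aE naD.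
  have [a3a va vaM faB] : [/\ a3 != a, v != a, [set v; a] \in M3 &
      [set a3; a] \notin B2].
    by case: aE => ->; split=> //; rewrite ?[[set a3; _]]setUC // !inE eqxx ?orbT.
  (* All of Maker's edges meet at [v], so she does not yet own the closing edge. *)
  have v_in e : e \in M3 -> v \in e.
    by rewrite !inE orbF => /or3P[]/eqP->; rewrite !inE eqxx.
  apply: (win_round a3a) => [||D4 _ _ _].
  - apply/negP => /v_in; rewrite !inE => /orP[]; apply/negP => //.
  - by rewrite inE negb_or naD.
  apply: win_of_goal; first exact: has_triangle_sub.
  exists v, a3, a; rewrite /adj /= a3v a3a va /=; split.
  - by rewrite !inE eqxx !orbT.
  - by rewrite !inE eqxx.
  by rewrite in_setU vaM orbT.
have [] := trivIset_choice a3 tD3 a2a1; apply: closing; [by right|by left].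
Qed.

Lemma maker_wins_triangle first : maker_wins (@has_triangle n) first b.
Proof.
apply: maker_wins_of_win; case: first.
  by apply: win_triangle_start => v; rewrite /deg setIdE set0I cards0.
apply: win_breaker => D _ _ tD; rewrite setU0; apply: win_triangle_start => v.
exact: deg_trivIset.
Qed.

End TriangleGame.

(** * Consecutive triples and insertion in lists *)

Lemma three_consecutive (T : Type) (a : pred T) (s : seq T) :
  3 * (count a s).+1 <= size s ->
  exists s1 x y z s2,
    s = s1 ++ [:: x, y, z & s2] /\ [&& ~~ a x, ~~ a y & ~~ a z].
Proof.
(* Cut the list into blocks of three: each bad element spoils at most one block, and there are more
   blocks than bad elements. *)
have [k] := ubnP (size s); elim: k s => // k IH [|x [|y [|z s]]] //=; try lia.
move=> lt_k le; have [xyz|xyz] := boolP [&& ~~ a x, ~~ a y & ~~ a z].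
  by exists [::], x, y, z, s.
have [||s1 [x' [y' [z' [s2 [-> h]]]]]] := IH s; [by lia| |].
  by move: xyz le; case: (a x); case: (a y); case: (a z) => //= _; lia.
by exists [:: x, y, z & s1], x', y', z', s2.
Qed.

Lemma sorted_insert (T : Type) (e : rel T) s1 x u y s2 :
  sorted e (s1 ++ [:: x, y & s2]) -> e x u -> e u y ->
  sorted e (s1 ++ [:: x, u, y & s2]).
Proof.
move=> + xu uy; case: s1 => [|w s1]; rewrite /= ?cat_path /= xu uy.
  by case/andP.
by case/and4P=> -> -> _ ->.
Qed.

(** * Absorbing a vertex into Maker's path *)

Section HamiltonicityGame.

Variables (n b thr : nat).

Implicit Types (P : seq 'I_n) (M B D : graph n) (u v w x y z : 'I_n).

Definition heavy P B := #|[set v in P | thr < deg B v]|.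

(* [hs_out] survives the absorption of the outside vertex of maximal degree: two
   rounds add at most 2 to every degree, and either that vertex becomes a new
   heavy vertex of the path, or all outside degrees were at most [thr]. *)
Record ham_state P M B : Prop := HamState {
  hs_uniq : uniq P;
  hs_path : sorted (adj M) P;
  hs_inside : forall e v, e \in M -> v \in e -> v \in P;
  hs_size : 1 < size P;
  hs_board : B \subset board n;
  hs_card : #|B| <= 2 * size P * b;
  hs_deg : forall v, deg B v <= 2 * size P;
  hs_out : forall u, u \notin P -> deg B u <= thr + 2 * heavy P B + 2 }.

(** Markov's inequality for the degree sum. *)
Lemma heavy_bound P B : B \subset board n -> heavy P B * thr.+1 <= 2 * #|B|.
Proof.
move=> /sum_deg <-; rewrite /heavy -sum_nat_const.
rewrite [leqRHS](bigID (fun v => v \in [set v in P | thr < deg B v])) /=.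
apply: leq_trans (leq_addr _ _); apply: leq_sum => v.
by rewrite inE => /andP[].
Qed.

Lemma uniq_size_ord P : uniq P -> size P <= n.
Proof. by move=> /card_uniqP <-; rewrite -[leqRHS]card_ord max_card. Qed.

(** Bookkeeping shared by both ways of absorbing [u]: two Breaker turns add at most [2 * b] edges
    and 2 to each degree, paid for by the growth of the path. *)
Lemma ham_state_step P M B u D1 D2 P' M' :
  ham_state P M B -> u \notin P ->
  (forall w, w \notin P -> deg B w <= deg B u) ->
  D1 \subset board n -> #|D1| <= b -> trivIset D1 ->
  D2 \subset board n -> #|D2| <= b -> trivIset D2 ->
  uniq P' -> sorted (adj M') P' ->
  (forall e v, e \in M' -> v \in e -> v \in P') ->
  {subset u :: P <= P'} ->
  size P < size P' /\ ham_state P' M' (D2 :|: (D1 :|: B)).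
Proof.
move=> [UP _ _ sP Bb cB dB oB] uP umax D1b cD1 tD1 D2b cD2 tD2 UP' pP' inP' sub.
set B' := D2 :|: (D1 :|: B).
have ltP : size P < size P'.
  by apply: (@uniq_leq_size _ (u :: P)) => //=; rewrite uP.
have degB' w : deg B' w <= deg B w + 2.
  apply: leq_trans (deg_move _ _ tD2) _; rewrite addn2 ltnS; exact: deg_move.
have degS w : deg B w <= deg B' w.
  by apply: deg_sub; rewrite /B' setUA subsetUr.
split=> //; split=> //.
- by apply: leq_trans ltP; apply: ltnW.
- by rewrite !subUset D1b D2b.
- have c1 := leq_of_leqif (leq_card_setU D2 (D1 :|: B)).
  have c2 := leq_of_leqif (leq_card_setU D1 B).
  apply: leq_trans c1 _; apply: leq_trans (leq_add cD2 (leq_trans c2 (leq_add cD1 cB))) _.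
  apply: (@leq_trans (2 * (size P).+1 * b)).
    by rewrite mulnSr mulnDl addnA addnC leq_add2l mul2n addnn.
  by apply: leq_mul => //; apply: leq_mul.
- move=> v; apply: leq_trans (degB' v) _; apply: (@leq_trans (2 * (size P).+1)).
    by rewrite mulnS addnC leq_add2l.
  by rewrite leq_mul2l.
move=> w wP'.
have wP : w \notin P by apply: contra wP' => wP; apply: sub; rewrite inE wP orbT.
have [lt_u|le_u] := ltnP thr (deg B u); last first.
  apply: leq_trans (degB' w) _; rewrite leq_add2r.
  exact: leq_trans (umax w wP) (leq_trans le_u (leq_addr _ _)).
(* Degrees never decrease, so old heavy vertices stay heavy, and [u] is a new one. *)
have lt_heavy : heavy P B < heavy P' B'.
  apply: proper_card; apply/properP; split.
    apply/subsetP=> v; rewrite !inE => /andP[vP lt_v].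
    by rewrite sub ?inE ?vP ?orbT //=; apply: leq_trans (degS v).
  exists u; rewrite !inE ?(negPf uP) // sub ?inE ?eqxx //=.
  exact: leq_trans (degS u).
apply: leq_trans (degB' w) _; rewrite leq_add2r.
apply: leq_trans (oB w wP) _; rewrite -addnA leq_add2l -mulnSr.
by rewrite leq_mul2l.
Qed.

Local Notation win := (win b (@has_hamiltonian_path n)).

(** The last hypothesis is the continuation of the game, supplied by induction on the number of
    outside vertices. *)
Lemma win_ham_extend P M B u : ham_state P M B -> u \notin P ->
  (forall w, w \notin P -> deg B w <= deg B u) ->
  7 * size P + 1 < n ->
  (forall P' M' B', size P < size P' -> ham_state P' M' B' ->
     win Maker (Position M' B')) ->
  win Maker (Position M B).
Proof.
move=> st uP umax small IH; have [UP pP inP sP _ _ dB _] := st.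
case: P UP pP inP sP dB st uP umax small IH => // x P' /=.
set y := last x P'; set P := x :: P'.
move=> UP pP inP sP dB st uP umax small IH.
(* The ends must differ for the two threats at [z] to be distinct edges. *)
have xy : x != y.
  apply: contraTneq UP => ->; rewrite /y; case/lastP: P' sP {st P pP inP uP umax dB small IH y} => // s z _.
  by rewrite last_rcons mem_rcons inE eqxx.
have yP : y \in P by rewrite /y mem_last.
(* At most [size P + 1] vertices are excluded outright, and [x], [y], [u] have Breaker degree at
   most [2 * size P] each: hence the bound [7 * size P + 1]. *)
have [|z [+ fxz fyz fuz]] := @exists_free_vertex n B [set v in u :: P] x y u.
  have cA : #|[set v in u :: P]| <= (size P).+1.
    by rewrite cardsE; apply: leq_trans (card_size _) _.
  apply: leq_ltn_trans (leq_add (leq_add (leq_add cA (dB _)) (dB _)) (dB _)) _.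
  by rewrite /P /=; lia.
rewrite inE [z \in _]inE negb_or => /andP[zu zP].
(* Maker's edges stay inside the path, so none reaches an outside vertex. *)
have notM a c : a \notin P -> [set c; a] \notin M.
  by move=> aP; apply: contra aP => /inP -> //; rewrite !inE eqxx orbT.
rewrite eq_sym in zu.
apply: (win_round zu _ fuz) => [|D1 D1b cD1 tD1]; first exact: notM.
set M1 := [set u; z] |: M.
have sub1 : M \subset M1 by apply: subsetUr.
have adj_uz : adj M1 u z by rewrite /adj /= zu !inE eqxx.
have notM1 a : a \in P -> [set a; z] \notin M1.
  move=> aP; rewrite in_setU1 negb_or notM // andbT setUC [X in _ != X]setUC.
  by rewrite (inj_eq (@set2_inj n z)); apply: contraNneq uP => <-.
have neq a : a \in P -> a != z by move=> aP; apply: contraNneq zP => <-.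
(* Both ends are treated at once: [a] is the end whose edge to [z] is still free, [P2] the
   lengthened path. *)
have finish a P2 : a \in P -> [set a; z] \notin D1 -> [set a; z] \notin B ->
    (forall M2, subrel (adj M1) (adj M2) -> adj M2 a z -> sorted (adj M2) P2) ->
    perm_eq P2 [:: u, z & P] ->
    win Maker (Position M1 (D1 :|: B)).
  move=> aP naD naB pP2 eqP2.
  apply: (win_round (neq a aP)) => [||D2 D2b cD2 tD2].
  - exact: notM1.
  - by rewrite inE negb_or naD.
  have mem2 : P2 =i [:: u, z & P] by apply: perm_mem.
  have [] := @ham_state_step P M B u D1 D2 P2 ([set a; z] |: M1) st uP umax D1b cD1 tD1 D2b cD2 tD2.
  - by rewrite (perm_uniq eqP2) /= inE negb_or zu uP zP.
  - apply: pP2; first by apply: adj_sub; apply: subsetUr.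
    by rewrite /adj /= neq // !inE eqxx.
  - move=> e v; rewrite mem2 !in_setU1 => /or3P[/eqP->|/eqP->|eM ve].
    + by rewrite !inE => /orP[]/eqP->; rewrite ?eqxx ?orbT // -in_cons aP !orbT.
    + by rewrite !inE => /orP[]/eqP->; rewrite ?eqxx ?orbT.
    + by rewrite 2!inE (inP _ _ eM ve) !orbT.
  - by move=> v; rewrite mem2 !inE => /or3P[]->; rewrite ?orbT.
  exact: IH.
have [nD|nD] : [set x; z] \notin D1 \/ [set y; z] \notin D1.
  by rewrite ![[set _; z]]setUC; apply: trivIset_choice.
- apply: (finish x [:: u, z & P]) => //; first by rewrite inE eqxx.
  move=> M2 sub2 adjx; rewrite /= sub2 //= adj_sym adjx /=.
  by apply: sub_path pP => v w; move/(adj_sub sub1)/sub2.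
apply: (finish y (P ++ [:: z; u])) => //.
  move=> M2 sub2 adjy; rewrite /= cat_path /= -/y adjy adj_sym sub2 //= andbT.
  by apply: sub_path pP => v w; move/(adj_sub sub1)/sub2.
by rewrite perm_catC; apply/permP => q /=; rewrite addnCA.
Qed.

Lemma win_ham_insert P M B u : ham_state P M B -> u \notin P ->
  (forall w, w \notin P -> deg B w <= deg B u) ->
  3 * (deg B u).+1 <= size P ->
  (forall P' M' B', size P < size P' -> ham_state P' M' B' ->
     win Maker (Position M' B')) ->
  win Maker (Position M B).
Proof.
move=> st uP umax large IH; have [UP pP inP sP _ _ dB _] := st.
have [|s1 [x [y [z [s2 [defP /and3P[]]]]]]] := @three_consecutive _ (fun w => [set u; w] \in B) P.
  (* The path vertices barred to [u] are distinct Breaker neighbours, so there are at most [deg B u]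
     of them. *)
  apply: leq_trans large; rewrite leq_mul2l /= ltnS.
  apply: leq_trans (card_nbrs B u).
  rewrite -size_filter -(card_uniqP (filter_uniq _ UP)).
  by apply: subset_leq_card; apply/subsetP=> w; rewrite mem_filter inE => /andP[].
move=> fx fy fz.
have [xP yP zP] : [/\ x \in P, y \in P & z \in P].
  by rewrite defP; split; rewrite mem_cat !inE eqxx !orbT.
have neq a : a \in P -> u != a by move=> aP; apply: contraNneq uP => ->.
have notM a : [set u; a] \notin M.
  by apply: contra uP => /inP -> //; rewrite !inE eqxx.
have xz : x != z.
  by move: UP; rewrite defP cat_uniq => /and3P[_ _ /=]; rewrite !inE; case: (x =P z) => //; rewrite orbT.
have yx : x != y.
  by move: UP; rewrite defP cat_uniq => /and3P[_ _ /=]; rewrite !inE; case: (x =P y).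
have yz : z != y.
  move: UP; rewrite defP cat_uniq => /and3P[_ _ /=]; rewrite !inE [z == y]eq_sym.
  by case: (y =P z) => //; rewrite andbF.
apply: (win_round (neq y yP) _ fy) => [|D1 D1b cD1 tD1]; first exact: notM.
set M1 := [set u; y] |: M.
have finish a P2 : a \in P -> a != y -> [set u; a] \notin D1 -> [set u; a] \notin B ->
    (forall M2, subrel (adj M) (adj M2) -> adj M2 u a -> adj M2 u y ->
       sorted (adj M2) P2) ->
    perm_eq P2 (u :: P) ->
    win Maker (Position M1 (D1 :|: B)).
  move=> aP ay naD naB pP2 eqP2.
  apply: (win_round (neq a aP)) => [||D2 D2b cD2 tD2].
  - by rewrite in_setU1 negb_or notM andbT (inj_eq (@set2_inj n u)).
  - by rewrite inE negb_or naD.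
  have mem2 : P2 =i u :: P by apply: perm_mem.
  have [] := @ham_state_step P M B u D1 D2 P2 ([set u; a] |: M1) st uP umax D1b cD1 tD1 D2b cD2 tD2.
  - by rewrite (perm_uniq eqP2) /= uP.
  - apply: pP2; first by apply: adj_sub; apply: subset_trans (subsetUr _ _); apply: subsetUr.
    + by rewrite /adj /= neq // !inE eqxx.
    + by rewrite /adj /= neq // !inE eqxx orbT.
  - move=> e v; rewrite mem2 !in_setU1 => /or3P[/eqP->|/eqP->|eM ve].
    + by rewrite !inE => /orP[]/eqP->; rewrite ?eqxx // aP orbT.
    + by rewrite !inE => /orP[]/eqP->; rewrite ?eqxx // yP orbT.
    + by rewrite inE (inP _ _ eM ve) orbT.
  - by move=> v; rewrite mem2.
  exact: IH.
(* The surviving edge puts [u] between [x] and [y], or between [y] and [z]. *)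
have [nD|nD] := trivIset_choice u tD1 xz.
  apply: (finish x (s1 ++ [:: x, u, y, z & s2])) => //.
    move=> M2 /sub_sorted sub2 adjx adjy; apply: sorted_insert => //.
      by rewrite -defP; apply: sub2.
    by rewrite adj_sym.
  by rewrite defP -cat_rcons (perm_catCA _ [:: u]) /= cat_rcons.
apply: (finish z (s1 ++ [:: x, y, u, z & s2])) => //.
  move=> M2 /sub_sorted sub2 adjz adjy.
  rewrite -cat_rcons; apply: sorted_insert => //; last by rewrite adj_sym.
  by rewrite cat_rcons -defP; apply: sub2.
by rewrite defP -cat_rcons -cat_rcons (perm_catCA _ [:: u]) /= !cat_rcons.
Qed.

End HamiltonicityGame.

(* [h] bounds the number of heavy vertices: each has more than n/60 of the at
   most 2lb Breaker edges, so [h <= 240 b]. *)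
Lemma long_path_bound n b l h d : 1000 <= n -> 200 * (100 * b) <= n ->
  l <= n -> n <= 7 * l + 1 ->
  h * (n %/ 60).+1 <= 2 * (2 * l * b) -> d <= n %/ 60 + 2 * h + 2 ->
  3 * d.+1 <= l.
Proof.
move=> n_ge b_le l_le l_ge h_le d_le.
have h_b : h <= 240 * b.
  have n_thr : n <= 60 * (n %/ 60).+1 by lia.
  rewrite -(@leq_pmul2r n); last lia.
  have /leq_trans -> // : h * n <= 60 * (h * (n %/ 60).+1).
    by rewrite mulnCA leq_mul2l n_thr orbT.
  apply: (@leq_trans (60 * (2 * (2 * l * b)))); first by rewrite leq_mul2l h_le.
  have : l * b <= n * b by rewrite leq_mul2r l_le orbT.
  lia.
lia.
Qed.

(** * Hamiltonicity with a linear bias *)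

Section HamiltonicityWin.

Variables (n b : nat).
Hypothesis n_ge : 1000 <= n.
Hypothesis b_le : 200 * (100 * b) <= n.

Local Notation win := (win b (@has_hamiltonian_path n)).
(** The cut-off 60 and the ratio 20000 keep outside degrees below about [n / 24] in the insertion
    phase; three times that fits in a path of about [n / 7] vertices, where extension stops. *)
Let thr := n %/ 60.

Lemma win_ham_state (P : seq 'I_n) M B :
  ham_state b thr P M B -> win Maker (Position M B).
Proof.
have [k] := ubnP (n - size P); elim: k P M B => // k IH P M B lt_k st.
have [/existsP[u0 u0P]|all_in] := boolP [exists u, u \notin P]; last first.
  apply: win_of_goal; first exact: has_hamiltonian_path_sub.
  exists P; split; [exact: hs_uniq st| |exact: hs_path st].
  by move=> v; move: all_in; rewrite negb_exists => /forallP/(_ v); rewrite negbK.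
have [u uP umax] : exists2 u, u \notin P & forall w, w \notin P -> deg B w <= deg B u.
  by case: (@arg_maxnP _ u0 [pred u | u \notin P] (deg B) u0P) => u uP umax; exists u.
have IH' P' M' B' : size P < size P' -> ham_state b thr P' M' B' ->
    win Maker (Position M' B').
  move=> ltP st'; apply: (IH P') => //.
  by have := uniq_size_ord (hs_uniq st'); lia.
have [small|large] := ltnP (7 * size P + 1) n.
  exact: win_ham_extend st uP umax small IH'.
apply: (win_ham_insert st uP umax _ IH').
apply: (long_path_bound n_ge b_le _ large _ (hs_out st uP)).
  exact: uniq_size_ord (hs_uniq st).
apply: leq_trans (heavy_bound _ _ (hs_board st)) _.
by rewrite leq_mul2l (hs_card st).
Qed.

(** One round yields a two-vertex path; Breaker degrees are then at most 2, within the additive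
    constant of [hs_out]. *)
Lemma win_ham_start (B : graph n) : B \subset board n -> #|B| <= b ->
  (forall v, deg B v <= 1) -> win Maker (Position set0 B).
Proof.
move=> Bb cB degB; have n0 : 0 < n by lia.
pose x := Ordinal n0.
have [|y [+ fy _ _]] := @exists_free_vertex n B [set x] x x x.
  by rewrite cards1; have := degB x; lia.
rewrite !inE eq_sym => xy.
apply: (win_round xy _ fy) => [|D Db cD tD]; first by rewrite inE.
have degB' v : deg (D :|: B) v <= 2.
  by apply: leq_trans (deg_move B v tD) _; apply: degB.
apply: (@win_ham_state [:: x; y]); split=> //.
- by rewrite /= inE xy.
- by rewrite /= /adj /= xy !inE eqxx.
- by move=> e v; rewrite in_setU1 in_set0 orbF => /eqP->; rewrite !inE.
- by rewrite subUset Db.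
- apply: leq_trans (leq_of_leqif (leq_card_setU _ _)) _.
  by apply: leq_trans (leq_add cD cB) _; rewrite /=; lia.
- by move=> v; apply: leq_trans (degB' v) _.
by move=> u _; apply: leq_trans (degB' u) _; lia.
Qed.

Lemma maker_wins_ham first : maker_wins (@has_hamiltonian_path n) first b.
Proof.
apply: maker_wins_of_win; case: first.
  apply: win_ham_start; rewrite ?sub0set ?cards0 //.
  by move=> v; rewrite /deg setIdE set0I cards0.
apply: win_breaker => D Db cD tD; rewrite setU0; apply: win_ham_start => // v.
exact: deg_trivIset.
Qed.

End HamiltonicityWin.

(** * From Hamiltonian paths to spanning trees *)

Lemma has_spanning_tree_of_ham n (G : graph n) :
  has_hamiltonian_path G -> has_spanning_tree G.
Proof.
move=> [p [Up pT pG]].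
(* [G] may contain chords of [p]; only edges between consecutive positions are kept. *)
pose T := [set e in G | [exists u, exists v,
  (e == [set u; v]) && (index v p == (index u p).+1)]].
have adjT u v : adj T u v ->
    index v p = (index u p).+1 \/ index u p = (index v p).+1.
  rewrite /adj /= inE => /and3P[uv _ /existsP[a /existsP[c /andP[/eqP E /eqP i_ac]]]].
  have : u \in [set a; c] by rewrite -E !inE eqxx.
  have : v \in [set a; c] by rewrite -E !inE eqxx orbT.
  rewrite !inE => /orP[]/eqP ? /orP[]/eqP ?; subst; try by [left|right].
    by rewrite eqxx in uv.
  by rewrite eqxx in uv.
exists T; first by apply/subsetP=> e; rewrite inE => /andP[].
split.
  have sT : sorted (adj T) p.
    case: p Up pT pG @T adjT => // x p Up pT pG T _.
    apply/(pathP x) => i ip.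
    have /andP[neq inG] := pathP x pG i ip.
    apply/andP; split=> //; rewrite inE inG.
    apply/existsP; exists (nth x (x :: p) i).
    apply/existsP; exists (nth x (x :: p) i.+1); rewrite eqxx.
    by rewrite !index_uniq //=; apply: ltnW.
  have Tsym : connect_sym (adj T) by apply: sym_connect_sym; apply: adj_sym.
  case: p {Up pG} pT @T adjT sT Tsym => [pT T _ _ _ u|x p pT T _ sT Tsym u v].
    by have := pT u.
  apply: (@connect_trans _ _ x); first rewrite Tsym.
    exact: (@path_connect _ (adj T) x p sT u (pT u)).
  exact: (@path_connect _ (adj T) x p sT v (pT v)).
move=> c size_c /andP[cyc Uc].
have [x0 x0c] : exists x0, x0 \in c by case: c size_c {cyc Uc} => // a ? _; exists a; rewrite inE eqxx.
(* Both cycle neighbours of the vertex of largest index have index one less, so they coincide,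
   impossible in a cycle of length at least 3. *)
have [x xc xmax] := @arg_maxnP _ x0 (mem c) (fun v => index v p) x0c.
have [i s def_c] := rot_to xc.
have := cyc; rewrite -(rot_cycle i) def_c /=.
have := Uc; rewrite -(rot_uniq i) def_c.
have : 2 < size (x :: s) by rewrite -def_c size_rot.
have smax v : v \in s -> index v p <= index x p.
  by move=> vs; apply: xmax; rewrite /= -(mem_rot i) def_c inE vs orbT.
case: s {def_c} smax => [|y s] // smax; case/lastP: s smax => [|s z] // smax _ U.
rewrite rcons_path last_cons last_rcons /= => /andP[/andP[/adjT xy _] /adjT zx].
have yz : index y p = index z p.
  have := smax y; have := smax z; rewrite !inE mem_rcons !inE !eqxx !orbT.
  move=> /(_ isT) zx' /(_ isT) yx'.
  case: xy => xy; first by rewrite xy ltnn in yx'.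
  case: zx => zx; last by rewrite zx ltnn in zx'.
  by apply: succn_inj; rewrite -xy -zx.
have : y = z by rewrite -(nth_index y (pT y)) yz nth_index.
by move=> yz'; move: U; rewrite /= yz' mem_rcons inE eqxx /= andbF.
Qed.

Lemma maker_wins_imply n (goal goal' : graph n -> Prop) first b :
  (forall G, goal G -> goal' G) -> maker_wins goal first b ->
  maker_wins goal' first b.
Proof.
move=> sub [s sL sw]; exists s => // t /sw[G Gf Gg]; exists G => //; exact: sub.
Qed.

(* Asymptotics of the thresholds *)
From mathcomp Require Import all_order all_algebra.
From mathcomp Require Import all_classical reals topology normedtype landau.
Import Order.TTheory GRing.Theory Num.Theory.
Import numFieldNormedType.Exports.
Local Open Scope classical_set_scope.
Local Open Scope ring_scope.

(** The upper bound is automatic from [n./2]; a linear winning bias for Maker gives the lower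
    one. *)
Lemma threshold_Theta (R : realType) first
    (goal : forall n, graph n -> Prop) (K N : nat) :
  (forall n, (N <= n)%N -> exists b, [/\ (b <= n./2)%N, (n <= K * b)%N &
     maker_wins (@goal n) first b]) ->
  exists2 b0 : nat -> nat,
    \forall n \near \oo, is_threshold_bias (@goal n) first (b0 n) &
    (fun n => (b0 n)%:R : R) =Theta_\oo (fun n => n%:R : R).
Proof.
move=> H; exists (fun n => threshold (@goal n) first).
  by exists N => // n /H[b [bn _ bw]]; apply: thresholdP bn bw.
rewrite eqThetaE bigThetaE eqOmegaO; split; apply/eqO_exP.
  exists 1 => //; exists N => // n _; rewrite /= mul1r !ger0_norm // ler_nat.
  by apply: leq_trans (threshold_le _ _) _; lia.
(* The successor makes the constant positive even when [K] is 0. *)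
exists (K.+1)%:R; first by rewrite ltr0n.
exists N => // n /H[b [bn nb bw]] /=.
rewrite !ger0_norm // -natrM ler_nat (leq_trans nb) // leq_mul //.
exact: le_threshold bn bw.
Qed.

Theorem theorem1p5 (R : realType) (first : player) :
  (exists2 b0 : nat -> nat,
     \forall n \near \oo, is_threshold_bias (@has_triangle n) first (b0 n) &
     (fun n => (b0 n)%:R : R) =Theta_\oo (fun n => n%:R : R)) /\
  (exists2 b0 : nat -> nat,
     \forall n \near \oo, is_threshold_bias (@has_spanning_tree n) first (b0 n) &
     (fun n => (b0 n)%:R : R) =Theta_\oo (fun n => n%:R : R)) /\
  (exists2 b0 : nat -> nat,
     \forall n \near \oo, is_threshold_bias (@has_hamiltonian_path n) first (b0 n) &
     (fun n => (b0 n)%:R : R) =Theta_\oo (fun n => n%:R : R)).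
Proof.
have ham n : (200 * 100 <= n)%N -> exists b, [/\ (b <= n./2)%N,
    (n <= 400 * 100 * b)%N & maker_wins (@has_hamiltonian_path n) first b].
  (* Rounding down loses at most a factor 2 once [n] is at least 20000, hence 400 in place of
     200. *)
  move=> n_ge; exists (n %/ (200 * 100))%N; split; [lia|lia|].
  by apply: maker_wins_ham; lia.
split; last split.
(* Maker wins even at the largest bias [n./2]; the factor 3 absorbs the rounding. *)
- apply: (@threshold_Theta _ _ _ 3 20) => n n_ge.
  by exists n./2; split=> //; [lia|exact: maker_wins_triangle].
- apply: (@threshold_Theta _ _ _ (400 * 100) (200 * 100)) => n /ham[b [bn nb bw]].
  exists b; split=> //; apply: maker_wins_imply _ bw.
  exact: has_spanning_tree_of_ham.
exact: threshold_Theta ham.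
Qed.
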